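(* For $n\in\mathbb{N}$ and any $\theta,b>0$ the following equality in distribution holds: $$N_\theta(\beta_{n,b})\overset{d}{=}\sum_{i=1}^nG_i(b,\theta),$$ where $N_\theta$ is the process counting the $\mathsf{GEM}(\theta)$ cut-points, $\beta_{n,b}$ is a random variable independent of the $\mathsf{GEM}(\theta)$ cut-points with the beta$(n,b)$ distribution (density at $u\in(0,1)$ proportional to $u^{n-1}(1-u)^{b-1}$), the summands $G_i(b,\theta)$ are mutually independent, and $G_i(b,\theta)$ has the geometric$(\tau_i(b,\theta))$ distribution with $$\tau_i(b,\theta)=\frac{b+i-1}{b+i-1+\theta}.$$
   Context: $\mathbb{N}=\{1,2,\dots\}$, and $\overset{d}{=}$ denotes equality in distribution. The geometric$(\tau)$ distribution is the one on $\{0,1,2,\dots\}$ with $\mathbb{P}[G=k]=\tau(1-\tau)^k$. The $\mathsf{GEM}(\theta)$ cut-points are $Y_k=1-\prod_{i=1}^k(1-H_i)$, $k\in\mathbb{N}$, where $H_1,H_2,\dots$ are i.i.d. with the beta$(1,\theta)$ distribution (density $\theta(1-x)^{\theta-1}$ on $[0,1]$). The counting process is $N_\theta(u)=\sum_{k=1}^\infty\mathbf{1}_{\{Y_k\le u\}}$ for $0\le u\le1$. *)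

(* Defs.v *)
From HB Require Import structures.
From mathcomp Require Import all_boot all_order all_algebra finmap.
From mathcomp Require Import all_classical all_reals all_analysis.
From mathcomp Require Import measurable_realfun.

Set Implicit Arguments.
Unset Strict Implicit.
Unset Printing Implicit Defensive.

Import Order.TTheory GRing.Theory Num.Theory.
Import numFieldNormedType.Exports.

Local Open Scope classical_set_scope.
Local Open Scope ring_scope.

(* The beta distribution with real parameters (the library's [beta_prob] only
   has natural ones): the density is normalized by its own integral, which is
   positive and finite for a, b > 0. *)
Definition beta_weight (R : realType) (a b x : R) : R :=
  x `^ (a - 1) * (1 - x) `^ (b - 1).

Definition beta_law (R : realType) (a b : R) (A : set R) : \bar R :=
  ((fine (\int[lebesgue_measure]_(x in `]0%R, 1%R[) (beta_weight a b x)%:E))^-1%:E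
    * \int[lebesgue_measure]_(x in A `&` `]0%R, 1%R[) (beta_weight a b x)%:E)%E.

Definition has_beta_law (d : measure_display) (T : measurableType d)
    (R : realType) (P : probability T R) (a b : R) (X : {RV P >-> R}) : Prop :=
  forall A : set R, measurable A -> distribution P X A = beta_law a b A.

Definition has_geometric_law (d : measure_display) (T : measurableType d)
    (R : realType) (P : probability T R) (tau : R) (X : {RV P >-> nat}) : Prop :=
  forall k : nat, distribution P X [set k] = (tau * (1 - tau) ^+ k)%:E.

(* Mutual independence of the subfamily (X i), i in D. *)
Definition mutually_independent (d d' : measure_display) (T : measurableType d)
    (T' : measurableType d') (R : realType) (P : probability T R)
    (I : choiceType) (D : set I) (X : I -> {RV P >-> T'}) : Prop :=
  forall (s : {fset I}) (A : I -> set T'),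
    [set` s] `<=` D -> (forall i, measurable (A i)) ->
    P (\bigcap_(i in [set` s]) (X i @^-1` A i)) =
    (\prod_(i <- s) fine (P (X i @^-1` A i)))%:E.

(* The sigma-algebra generated by the real functions (Y k), k in D. *)
Definition sigma_generated (T I : Type) (R : realType) (D : set I)
    (Y : I -> T -> R) : set (set T) :=
  <<s \bigcup_(k in D) preimage_set_system setT (Y k) measurable >>.

Definition independent_of_family (d : measure_display) (T : measurableType d)
    (R : realType) (P : probability T R) (I : Type) (D : set I)
    (X : {RV P >-> R}) (Y : I -> T -> R) : Prop :=
  forall (A : set R) (E : set T), measurable A -> sigma_generated D Y E ->
    P (X @^-1` A `&` E) = (P (X @^-1` A) * P E)%E.

(* Equality of laws for [0, +oo]-valued variables, on the Borel sets of
   \bar R; measurability is part of the assertion. *)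
Definition eq_in_distribution (d d' : measure_display) (T : measurableType d)
    (T' : measurableType d') (R : realType) (P : probability T R)
    (Q : probability T' R) (X : T -> \bar R) (X' : T' -> \bar R) : Prop :=
  [/\ measurable_fun setT X, measurable_fun setT X' &
    forall A : set (\bar R), measurable A -> P (X @^-1` A) = Q (X' @^-1` A)].

(* Sequences indexed by {1, 2, ...} are functions on nat whose value at 0 is
   never used. *)
Definition pos_indices : set nat := [set i | (1 <= i)%N].

Definition is_gem_sequence (d : measure_display) (T : measurableType d)
    (R : realType) (P : probability T R) (theta : R)
    (H : nat -> {RV P >-> R}) : Prop :=
  mutually_independent pos_indices H /\
  forall i : nat, (1 <= i)%N -> has_beta_law 1 theta (H i).

Definition cut_point (T : Type) (R : realType) (H : nat -> T -> R)
    (k : nat) (w : T) : R :=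
  1 - \prod_(1 <= i < k.+1) (1 - H i w).

(* N(u) as a function of the outcome w; +oo when infinitely many cut-points
   are at most u. *)
Definition count_cut_points (T : Type) (R : realType) (Y : nat -> T -> R)
    (u : R) (w : T) : \bar R :=
  (\sum_(1 <= k <oo) ((Y k w <= u)%R%:R)%:E)%E.

Definition geometric_parameter (R : realType) (b theta : R) (i : nat) : R :=
  (b + i%:R - 1) / (b + i%:R - 1 + theta).

(* Main.v *)
Require Import Defs.
From HB Require Import structures.
From mathcomp Require Import all_boot all_order all_algebra finmap.
From mathcomp Require Import all_classical all_reals all_analysis.
From mathcomp Require Import measurable_realfun.
From mathcomp Require Import ring lra.

Set Implicit Arguments.
Unset Strict Implicit.
Unset Printing Implicit Defensive.

Import Order.TTheory GRing.Theory Num.Theory.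
Import numFieldNormedType.Exports.

Local Open Scope classical_set_scope.
Local Open Scope ring_scope.

(** Write J(n, b, y) for the integral over ]y, 1[ of the unnormalized density
  x^(n-1) (1-x)^(b-1), and q(b) = theta / (theta + b).

  The cut-points Y_k increase almost surely, so N(u) >= k exactly when
  Y_k <= u, and independence gives
    P(N(beta) >= k) = P(Y_k <= beta) = E[J(n, b, Y_k)] / J(n, b, 0).
  Two facts make the expectation computable.  First, 1 - Y_k is a product of
  independent factors 1 - H_i, whose moments are E[(1-H_i)^s] = q(s); hence
  E[(1-Y_k)^s] = q(s)^k.  Second, since n is an integer, J can be reduced to
  powers of 1 - y by writing x^n (1-x)^(b-1) as
  x^(n-1) (1-x)^(b-1) - x^(n-1) (1-x)^b, that is
    J(1, b, y) = (1-y)^b / b,   J(n+1, b, y) = J(n, b, y) - J(n, b+1, y).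
  Therefore e(n, b, k) := E[J(n, b, Y_k)] satisfies e(1, b, k) = q(b)^k / b
  and e(n+1, b, k) = e(n, b, k) - e(n, b+1, k) (integral_beta_tail,
  probability_cut_point_le).

  On the other side, the law of the sum S_n of the first n geometric variables
  obeys a two-term recursion: a geometric variable is 0 with probability tau,
  and otherwise it is one more than a geometric variable, so that
    P(S_(n+1) = k+1) = tau P(S_n = k+1) + (1 - tau) P(S_(n+1) = k)
  with tau = tau_(n+1) (geometric_sum_pmfSS).  The tails
  e(n, b, k) / e(n, b, 0), and hence their differences in k, obey the same
  recursion, because
    (b+n+theta) e(n+1, b, k+1) = n e(n, b, k+1) + theta e(n+1, b, k),
  an identity that goes through by induction on n for all b at once
  (tail_momentS).  Both laws thus have the same point masses on the naturals;
  those of the sum add up to 1, so the counting variable is almost surely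
  finite and the laws agree (eq_in_distribution_nat). *)

(** * Integration against a measure given by a density *)

Import HBNNSimple.

(** Change of variables to the image under X of the measure with density g: the
  hypothesis is the case of indicators, from which simple functions follow by
  linearity and f by monotone convergence.  With X the identity and mu the Lebesgue
  measure this integrates against an explicit law; with mu a probability and g
  a function of other variables it expresses independence from X. *)
Lemma ge0_integral_density (d1 d2 : measure_display) (T1 : measurableType d1)
    (T2 : measurableType d2) (R : realType) (X : T1 -> T2) (g : T1 -> R)
    (mu : {measure set T1 -> \bar R}) (nu : {measure set T2 -> \bar R})
    (f : T2 -> \bar R) :
  measurable_fun setT X -> measurable_fun setT g -> (forall x, 0 <= g x) ->
  (forall A, measurable A -> (\int[mu]_(x in X @^-1` A) (g x)%:E = nu A)%E) ->
  measurable_fun setT f -> (forall y, 0 <= f y)%E ->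
  (\int[mu]_x ((g x)%:E * f (X x)) = \int[nu]_y f y)%E.
Proof.
move=> mX mg g0 gnu mf f0.
pose f_ := nnsfun_approx measurableT mf.
have cvgf y : EFin \o f_^~ y @ \oo --> f y.
  by apply: cvg_nnsfun_approx.
transitivity (limn (fun n => \int[nu]_y (f_ n y)%:E)%E); last first.
  rewrite -monotone_convergence//.
  - by apply: eq_integral => y _; apply: cvg_lim => //; exact: cvgf.
  - by move=> n; exact/measurable_EFinP/measurable_funP.
  - by move=> n y _; rewrite lee_fin.
  - by move=> y _ m n mn; rewrite lee_fin; exact/lefP/nd_nnsfun_approx.
have mfX n : measurable_fun setT (f_ n \o X) by exact: measurableT_comp.
transitivity (limn (fun n => \int[mu]_x (g x * f_ n (X x))%:E)%E).
  rewrite -monotone_convergence//.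
  - apply: eq_integral => x _; apply/esym; apply: cvg_lim => //.
    rewrite (_ : (fun n => _) = 
        (fun n => (g x)%:E * (EFin \o f_^~ (X x)) n)%E); last exact/funext.
    apply: cvgeZl => //; exact: cvgf.
  - by move=> n; apply/measurable_EFinP; apply: measurable_funM => //; exact: mfX.
  - by move=> n x _; rewrite lee_fin mulr_ge0.
  - move=> x _ m n mn; rewrite lee_fin ler_wpM2l//.
    exact/lefP/nd_nnsfun_approx.
congr (limn _); apply/funext => n.
have mXA A : measurable A -> measurable (X @^-1` A).
  by move=> mA; rewrite -(setTI (X @^-1` A)); exact: mX.
transitivity (\sum_(k \in range (f_ n)) (k%:E * nu (f_ n @^-1` [set k])))%E;
    last first.
  under eq_integral do rewrite fimfunE -fsumEFin//.
  rewrite ge0_integral_fsum//; last 2 first.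
  - by move=> r; exact/measurable_EFinP/measurable_funM.
  - by move=> r y _; rewrite nnfun_muleindic_ge0.
  apply: eq_fsbigr => r _.
  by rewrite integralZl_indic_nnsfun// integral_indic// setIT.
transitivity (\sum_(k \in range (f_ n))
    \int[mu]_x (g x * (k * \1_(X @^-1` (f_ n @^-1` [set k])) x))%:E)%E.
  rewrite -ge0_integral_fsum//.
  - apply: eq_integral => x _; rewrite fimfunE fsumEFin//.
    by rewrite mulr_fsumr.
  - by move=> r; apply/measurable_EFinP/measurable_funM => //;
      apply: measurable_funM => //; apply: measurable_indic; apply: mXA.
  - move=> r x _; rewrite lee_fin mulr_ge0//.
    by have := @nnfun_muleindic_ge0 _ _ _ (f_ n) r (X x); rewrite lee_fin.
apply: eq_fsbigr => r; rewrite inE => -[y _ <-].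
set k := f_ n y; have k0 : 0 <= k by [].
rewrite -gnu// -ge0_integralZl//; last first.
- by move=> x _; rewrite lee_fin.
- by apply/measurable_EFinP; exact: measurable_funTS.
- exact: mXA.
rewrite [RHS]integral_mkcond; apply: eq_integral => x _ /=.
rewrite patchE indicE; case: ifPn => _; rewrite ?mulr1 ?mulr0//.
by rewrite mulrC.
Qed.

(** * Powers of 1 - x *)

Section onem_powR.
Context {R : realType}.
Implicit Types (c s x : R).

Lemma is_derive_onem_powR s x : x < 1 ->
  is_derive x 1 (fun t : R => (1 - t) `^ s) (- (s * (1 - x) `^ (s - 1))).
Proof.
move=> x1.
have x1' : 0 < 1 - x by rewrite subr_gt0.
have dg : is_derive x (1 : R) (fun t : R => 1 - t) (- 1).
  by rewrite -[X in is_derive _ _ _ X]add0r; apply: is_deriveB.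
have df := @is_derive1_powR _ s (1 - x) x1'.
have dh := @is_derive1_comp R (@powR R ^~ s) (fun t : R => 1 - t) x _ _ df dg.
by apply: is_derive_eq; rewrite mulrN1.
Qed.

Lemma continuous_onem_powR s x : x < 1 ->
  {for x, continuous (fun t : R => (1 - t) `^ s)}.
Proof.
move=> /(is_derive_onem_powR s) dx.
by apply: differentiable_continuous; apply/derivable1_diffP; exact: ex_derive.
Qed.

Lemma measurable_onem_powR s (D : set R) :
  measurable_fun D (fun x => (1 - x) `^ s).
Proof.
apply: measurable_funTS; apply: (measurableT_comp (measurable_powR s)).
exact: measurable_funB.
Qed.

(** For s < 1 the integrand is unbounded at 1, so the fundamental theorem of
  calculus is applied on ]c, e] and e is sent to 1. *)
Lemma integral_onem_powR c s : 0 <= c < 1 -> 0 < s ->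
  (\int[lebesgue_measure]_(x in `]c, 1%R[) ((1 - x) `^ (s - 1))%:E =
   ((1 - c) `^ s / s)%:E)%E.
Proof.
move=> /andP[c0 c1] s0.
have sn0 : s != 0 by rewrite gt_eqF.
(* The geometric choice of endpoints makes (1 - e k)^s a geometric sequence,
   whose limit needs no continuity of the power function at 0. *)
pose e k : R := 1 - (1 - c) * 2^-1 ^+ k.+1.
have q01 k : 0 < (2^-1 : R) ^+ k.+1 < 1.
  by rewrite exprn_gt0//= exprn_ilt1//; lra.
have ce k : c < e k by rewrite /e; have := q01 k; nra.
have e1 k : e k < 1 by rewrite /e; have := q01 k; nra.
have leq_e : nondecreasing_seq e.
  apply/nondecreasing_seqP => k; rewrite /e (exprS _ k.+1).
  by have := q01 k; nra.
have cvgS (q : R) : 0 <= q < 1 -> q ^+ k.+1 @[k --> \oo] --> 0.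
  move=> /andP[q0 q1]; under eq_fun do rewrite exprS.
  suff : q * q ^+ k @[k --> \oo] --> q * 0 by rewrite mulr0.
  apply: cvgM; first exact: cvg_cst.
  by apply: cvg_expr; rewrite ger0_norm.
have cvge : e @ \oo --> (1 : R).
  suff : e @ \oo --> 1 - (1 - c) * 0 by rewrite mulr0 subr0.
  apply: cvgB; [exact: cvg_cst|apply: cvgM; [exact: cvg_cst|]].
  by apply: cvgS; lra.
have bigU : `]c, 1[%classic = \bigcup_k `]c, e k]%classic.
  apply/seteqP; split => [x /=|x [k _] /=]; rewrite !in_itv/=.
    move=> /andP[cx x1].
    have [k _ /(_ k (leqnn k)) /=] := cvgr_ge _ cvge _ x1.
    by move=> xk; exists k => //=; rewrite in_itv/= cx.
  by move=> /andP[-> xe]; exact: le_lt_trans (e1 k).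
rewrite bigU.
have mf k : measurable_fun `]c, e k] (EFin \o (fun x => (1 - x) `^ (s - 1))).
  by apply/measurable_EFinP; exact: measurable_onem_powR.
suff : (\int[lebesgue_measure]_(x in `]c, e k]) ((1 - x) `^ (s - 1))%:E)%E
    @[k --> \oo] --> ((1 - c) `^ s / s)%:E.
  apply: cvg_unique => //; apply: ge0_nondecreasing_set_cvg_integral => //.
  - move=> m n mn; apply/subsetPset => x /=; rewrite !in_itv/=.
    by move=> /andP[-> /le_trans]; apply; exact: leq_e.
  - by move=> k x _; rewrite lee_fin powR_ge0.
have Ik k : (\int[lebesgue_measure]_(x in `]c, e k]) ((1 - x) `^ (s - 1))%:E
    = ((1 - c) `^ s / s * (1 - (2^-1 `^ s) ^+ k.+1))%:E)%E.
  have dF x : x < 1 ->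
      is_derive x 1 (fun t : R => - s^-1 * (1 - t) `^ s) ((1 - x) `^ (s - 1)).
    move=> /(is_derive_onem_powR s) dx; apply: is_derive_eq.
    by rewrite /GRing.scale/= mulrNN mulrA mulVf ?mul1r.
  have cF x : x < 1 -> {for x, continuous (fun t : R => - s^-1 * (1 - t) `^ s)}.
    move=> /dF dx.
    apply: differentiable_continuous; apply/derivable1_diffP.
    exact: ex_derive.
  rewrite integral_itv_obnd_cbnd; last exact: mf.
  rewrite (continuous_FTC2 (F := fun t => - s^-1 * (1 - t) `^ s))//.
  - rewrite -EFinB; congr EFin.
    have -> : 1 - e k = (1 - c) * 2^-1 ^+ k.+1 by rewrite /e; ring.
    rewrite powRM ?subr_ge0 ?(ltW c1)//.
    by rewrite -powR_mulrn// powRAC powR_mulrn ?powR_ge0//; ring.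
  - apply: continuous_in_subspaceT => x; rewrite inE/= in_itv/= => /andP[_ xe].
    by apply: continuous_onem_powR; exact: le_lt_trans (e1 k).
  - split.
    + move=> x; rewrite in_itv/= => /andP[_ xe].
      by have := dF _ (lt_trans xe (e1 k)) => dx; exact: ex_derive.
    + exact/cvg_at_right_filter/cF.
    + exact/cvg_at_left_filter/cF.
  - move=> x; rewrite in_itv/= => /andP[_ xe].
    by have := dF _ (lt_trans xe (e1 k)) => dx; rewrite derive1E derive_val.
under eq_fun do rewrite Ik.
apply: cvg_EFin; first exact: nearW.
set l := (1 - c) `^ s / s.
suff : l * (1 - (2^-1 `^ s) ^+ k.+1) @[k --> \oo] --> l * (1 - 0).
  by rewrite subr0 mulr1.
apply: cvgM; [exact: cvg_cst|apply: cvgB; [exact: cvg_cst|apply: cvgS]].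
rewrite powR_ge0/=.
have := @gt0_ltr_powR R s s0 2^-1 1; rewrite powR1; apply; rewrite ?nnegrE//.
lra.
Qed.

End onem_powR.

(** * Beta laws *)

Section beta_law.
Context {R : realType}.
Implicit Types (b c x y : R).

(** The unnormalized upper tail at y of the beta(n+1, b) law, as a combination
  of powers of 1 - y. *)
Fixpoint beta_tail (n : nat) b y : R :=
  if n is n'.+1 then beta_tail n' b y - beta_tail n' (b + 1) y
  else (1 - y) `^ b / b.

Lemma beta_weightS n b x : 0 < b -> 0 < x < 1 ->
  beta_weight n.+2%:R b x =
  beta_weight n.+1%:R b x - beta_weight n.+1%:R (b + 1) x.
Proof.
move=> b0 /andP[x0 x1]; rewrite /beta_weight.
have xE (k : nat) : x `^ (k.+1%:R - 1) = x ^+ k.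
  by rewrite -natr1 addrK powR_mulrn ?ltW.
have x1E : (1 - x) `^ (b + 1 - 1) = (1 - x) * (1 - x) `^ (b - 1).
  by rewrite addrK mulr_powRB1// subr_ge0 ltW.
by rewrite !xE x1E exprS; ring.
Qed.

Lemma beta_weight1 b x : 0 <= x -> beta_weight 1 b x = (1 - x) `^ (b - 1).
Proof. by move=> x0; rewrite /beta_weight subrr powRr0 mul1r. Qed.

Lemma beta_weight_ge0 a b x : 0 <= beta_weight a b x.
Proof. by rewrite mulr_ge0 ?powR_ge0. Qed.

Lemma measurable_beta_weight a b (D : set R) :
  measurable_fun D (beta_weight a b).
Proof.
apply: measurable_funM; last exact: measurable_onem_powR.
by apply: measurable_funTS; exact: measurable_powR.
Qed.

(** The identity beta_weightS integrated over ]c, 1[; the induction carries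
  integrability along, since the recursion is a difference. *)
Lemma integral_beta_weight n b c : 0 < b -> 0 <= c < 1 ->
  lebesgue_measure.-integrable `]c, 1%R[
    (EFin \o beta_weight n.+1%:R b) /\
  (\int[lebesgue_measure]_(x in `]c, 1%R[) (beta_weight n.+1%:R b x)%:E =
   (beta_tail n b c)%:E)%E.
Proof.
move=> + c01; have /andP[c0 c1] := c01.
have in01 x : x \in (`]c, 1[%classic : set R) -> 0 < x < 1.
  by rewrite inE/= in_itv/= => /andP[/(le_lt_trans c0) -> ->].
elim: n b => [|n IHn] b b0.
  have I1 : (\int[lebesgue_measure]_(x in `]c, 1%R[) (beta_weight 1 b x)%:E =
   ((1 - c) `^ b / b)%:E)%E.
    rewrite -integral_onem_powR//; apply: eq_integral => x /in01 /andP[x0 _].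
    by rewrite beta_weight1 ?ltW.
  split=> //; apply/integrableP; split.
    by apply/measurable_EFinP; exact: measurable_beta_weight.
  under eq_integral do rewrite gee0_abs ?lee_fin ?beta_weight_ge0//.
  by rewrite [X in (X < _)%E]I1 ltry.
have [i1 I1] := IHn _ b0.
have [i2 I2] := IHn (b + 1) (addr_gt0 b0 ltr01).
have wE : {in `]c, 1[%classic, (EFin \o beta_weight n.+2%:R b) =1
    ((EFin \o beta_weight n.+1%:R b) \- (EFin \o beta_weight n.+1%:R (b + 1)))%E}.
  by move=> x /in01 x01 /=; rewrite beta_weightS.
split; first by apply: eq_integrable (integrableB _ i1 i2) => // x /wE.
transitivity (\int[lebesgue_measure]_(x in `]c, 1%R[)
    ((beta_weight n.+1%:R b x)%:E - (beta_weight n.+1%:R (b + 1) x)%:E))%E.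
  exact: eq_integral.
by rewrite integralB_EFin// I1 I2.
Qed.


Context (d : measure_display) (T : measurableType d) (P : probability T R).

Lemma has_beta_law_support a b (X : {RV P >-> R}) : has_beta_law a b X ->
  {ae P, forall w, 0 < X w < 1}.
Proof.
move=> lawX; exists (X @^-1` ~` `]0, 1[); split.
- by apply: measurable_funPTI; exact: measurableC.
- have := lawX (~` `]0, 1[) (measurableC (measurable_itv _)).
  by rewrite /beta_law setICl integral_set0 mule0.
- by move=> w /=; rewrite in_itv.
Qed.

Lemma has_beta_law_tail n b (X : {RV P >-> R}) y :
  has_beta_law n.+1%:R b X -> 0 < b -> 0 <= y < 1 ->
  P (X @^-1` `[y, +oo[) = (beta_tail n b y / beta_tail n b 0)%:E.
Proof.
move=> lawX b0 y01; have /andP[y0 y1] := y01.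
rewrite -[LHS]/(distribution P X `[y, +oo[) lawX//.
rewrite /beta_law (integral_beta_weight _ b0 _).2 ?lexx//= [in RHS]mulrC EFinM.
congr (_ * _)%E; rewrite -(integral_beta_weight _ b0 y01).2.
have [->|yn0] := eqVneq y 0.
  congr (integral _ _ _); apply/seteqP; split => x/=; rewrite !in_itv/=.
    by move=> [].
  by move=> /andP[x0 ->]; rewrite x0 (ltW x0).
rewrite -(@integral_itv_bndoo _ _ _ _ true true); last first.
  by apply/measurable_EFinP; exact: measurable_beta_weight.
congr (integral _ _ _); apply/seteqP; split => x/=; rewrite !in_itv/= ?andbT.
  by move=> [-> /andP[_ ->]].
by move=> /andP[yx x1]; rewrite yx x1 (lt_le_trans _ yx)// lt0r yn0.
Qed.

(** With the density theta (1-x)^(theta-1), this is the integral of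
  theta (1-x)^(theta+s-1) over ]0, 1[. *)
Lemma has_beta_law_moment theta s (X : {RV P >-> R}) :
  has_beta_law 1 theta X -> 0 < theta -> 0 < s ->
  (\int[P]_w ((1 - X w) `^ s)%:E = (theta / (theta + s))%:E)%E.
Proof.
move=> lawX t0 s0.
pose g x := theta * (beta_weight 1 theta x * \1_(`]0, 1[%classic) x).
have mg : measurable_fun setT g.
  apply: measurable_funM => //; apply: measurable_funM.
    exact: measurable_beta_weight.
  exact: measurable_indic.
have g0 x : 0 <= g x.
  by rewrite mulr_ge0 ?(ltW t0)// mulr_ge0 ?beta_weight_ge0.
have mf : measurable_fun setT (fun x : R => ((1 - x) `^ s)%:E).
  by apply/measurable_EFinP; exact: measurable_onem_powR.
transitivity (\int[distribution P X]_x ((1 - x) `^ s)%:E)%E.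
  by rewrite ge0_integral_distribution// => y; rewrite lee_fin powR_ge0.
transitivity (\int[lebesgue_measure]_x ((g x)%:E * ((1 - x) `^ s)%:E))%E.
  apply/esym.
  apply: (@ge0_integral_density _ _ (measurableTypeR R) _ R (fun x : R => x : R) g
    lebesgue_measure (distribution P X) (fun x => ((1 - x) `^ s)%:E)) => //;
    last by move=> y; rewrite lee_fin powR_ge0.
  move=> A mA; rewrite -[RHS]/(distribution P X A) [RHS]lawX// /beta_law.
  rewrite (integral_beta_weight 0 t0 _).2 ?lexx ?ltr01//=.
  rewrite subr0 powR1 div1r invrK integral_mkcondr -ge0_integralZl//; last 3 first.
  + apply/(measurable_restrict _ _ _).1 => //.
    by apply/measurable_EFinP; exact: measurable_beta_weight.
  + by move=> x _; apply: erestrict_ge0 => ? _; rewrite lee_fin beta_weight_ge0.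
  + by rewrite lee_fin ltW.
  apply: eq_integral => x _; rewrite /g patchE indicE.
  by case: ifPn => _; rewrite ?mulr1 ?mulr0 ?mule0.
transitivity (\int[lebesgue_measure]_(x in `]0%R, 1%R[)
    (theta%:E * ((1 - x) `^ (theta + s - 1))%:E))%E.
  rewrite [RHS]integral_mkcond; apply: eq_integral => x _.
  rewrite patchE /g indicE; case: ifPn; last by rewrite !mulr0 mul0e.
  rewrite inE/= in_itv/= => /andP[x0 x1].
  rewrite mulr1 -!EFinM -mulrA beta_weight1 ?ltW// -powRD//.
    by rewrite addrAC.
  by apply/implyP => _; rewrite subr_eq0 gt_eqF.
rewrite ge0_integralZl//; last 3 first.
- by apply/measurable_EFinP; exact: measurable_onem_powR.
- by move=> x _; rewrite lee_fin powR_ge0.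
- by rewrite lee_fin ltW.
rewrite integral_onem_powR ?lexx ?ltr01 ?addr_gt0//.
by rewrite subr0 powR1 -EFinM div1r.
Qed.

End beta_law.

(** * Independence *)

Section independence.
Context (d d' : measure_display) (T : measurableType d) (T' : measurableType d').
Context (R : realType) (P : probability T R).

(** The expectation of a product of functions of independent variables.  For
  indicators this is the definition of independence; the indicators are then
  replaced by general functions one index at a time, each step being an
  instance of ge0_integral_density with the other factors as density. *)
Lemma integral_prod_independent (I : choiceType) (D : set I)
    (X : I -> {RV P >-> T'}) (s : {fset I}) (F : I -> T' -> R) (e : I -> R) :
  mutually_independent D X -> [set` s] `<=` D ->
  (forall i, measurable_fun setT (F i)) -> (forall i x, 0 <= F i x) ->
  (forall i, i \in s -> \int[P]_w (F i (X i w))%:E = (e i)%:E)%E ->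
  (\int[P]_w (\prod_(i <- s) F i (X i w))%:E = (\prod_(i <- s) e i)%:E)%E.
Proof.
move=> indX sD mF F0 eF.
(* r lists the indices whose function may fail to be an indicator. *)
have [r sr] : exists r : seq I, {subset s <= r} by exists s.
have : forall i, i \in s -> i \notin r ->
    exists2 A, measurable A & F i = \1_A by move=> i /sr ->.
move: {sr} r => r.
elim: r F e mF F0 eF => [|j r IHr] F e mF F0 eF indF.
  have {}indF i : i \in s -> exists A, measurable A /\ F i = \1_A.
    by move=> /indF-/(_ isT)[A]; exists A.
  have /choice[A AP] : forall i, exists A, measurable A /\
      (i \in s -> F i = \1_A).
    move=> i; case: (boolP (i \in s)) => [/indF[A [mA FA]]|_].
      by exists A.
    by exists set0.
  have mA i : measurable (A i) by have [] := AP i.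
  have FA i : i \in s -> F i = \1_(A i) by have [] := AP i.
  have mXA i : measurable (X i @^-1` A i) by exact: measurable_funPTI.
  have := indX s A sD mA.
  have -> : \prod_(i <- s) fine (P (X i @^-1` A i)) = \prod_(i <- s) e i.
    rewrite big_seq [RHS]big_seq; apply: eq_bigr => i si.
    rewrite -[RHS]/(fine (e i)%:E) -eF// FA//.
    by have /= -> := integral_indic P measurableT (mXA i); rewrite setIT.
  move=> <-; rewrite -[in RHS](setIT (\bigcap_(i in _) _)) -integral_indic//.
    apply: eq_integral => w _; congr EFin; rewrite indicE.
    rewrite big_seq; under eq_bigr => i si do rewrite FA// indicE.
    case: (boolP (w \in _)) => [/set_mem wA|wA].
      by rewrite big1// => i si; rewrite mem_set//; exact: wA.
    have [i [si wAi]] : exists i, i \in s /\ ~ A i (X i w).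
      apply: contrapT => H; move/negP : wA; apply; apply/mem_set => i /= si.
      by apply: contrapT => H'; apply: H; exists i.
    apply/eqP; rewrite -big_seq prodf_seq_eq0; apply/hasP; exists i => //=.
    by rewrite (memNset wAi).
  apply: fin_bigcap_measurable => // i _; exact: mXA.
have [js|js] := boolP (j \in s); last first.
  apply: IHr => // i si ir; apply: indF => //.
  by rewrite inE negb_or ir andbT; apply: contraNneq js => <-.
pose g w := \prod_(i <- s | i != j) F i (X i w).
pose c := \prod_(i <- s | i != j) e i.
have e0 i : i \in s -> 0 <= e i.
  move=> si; rewrite -lee_fin -eF//.
  by apply: integral_ge0 => w _; rewrite lee_fin.
have c0 : 0 <= c.
  by rewrite /c big_seq_cond; apply: prodr_ge0 => i /andP[si _]; exact: e0.
have mFX i : measurable_fun setT (fun w => F i (X i w)).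
  exact: measurableT_comp.
have mg : measurable_fun setT g.
  rewrite /g; under eq_fun do rewrite -big_filter.
  by apply: measurable_prod => i _.
have ge0 w : 0 <= g w by apply: prodr_ge0.
have gj A : measurable A ->
    (\int[P]_(w in X j @^-1` A) (g w)%:E =
     mscale (NngNum c0) (distribution P (X j)) A)%E.
  move=> mA.
  pose F' i := if i == j then \1_A else F i.
  pose e' i := if i == j then fine (P (X j @^-1` A)) else e i.
  have mXA : measurable (X j @^-1` A) by exact: measurable_funPTI.
  have mF' i : measurable_fun setT (F' i).
    by rewrite /F'; case: ifP => // _; exact: measurable_indic.
  have F'0 i x : 0 <= F' i x by rewrite /F'; case: ifP.
  have eF' i : i \in s -> (\int[P]_w (F' i (X i w))%:E = (e' i)%:E)%E.
    move=> si; rewrite /F' /e'; case: ifP => [/eqP ->|_]; last exact: eF.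
    have /= -> := integral_indic P measurableT mXA; rewrite setIT fineK//.
    exact: fin_num_measure.
  have indF' i : i \in s -> i \notin r ->
      exists2 B, measurable B & F' i = \1_B.
    move=> si ir; rewrite /F'; case: eqP => [_|/eqP ij]; first by exists A.
    by apply: indF => //; rewrite inE negb_or ij.
  have := IHr F' e' mF' F'0 eF' indF'.
  rewrite [X in _ = X%:E](bigD1_seq j)//= /e' /mscale/= eqxx.
  under eq_bigr => i ij do rewrite (negbTE ij).
  rewrite -/c => E; rewrite muleC -[distribution P _ A]fineK; last first.
    exact: fin_num_measure.
  rewrite -EFinM -E integral_mkcond; apply: eq_integral => w _.
  rewrite (bigD1_seq j)//= /F' eqxx patchE indicE.
  under [in RHS]eq_bigr => i ij do rewrite (negbTE ij).
  have -> : (w \in X j @^-1` A) = (X j w \in A) by [].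
  by case: ifP; rewrite ?mul1r ?mul0r.
rewrite (bigD1_seq j)//= -/c.
transitivity (\int[mscale (NngNum c0) (distribution P (X j))]_x (F j x)%:E)%E.
  rewrite -(@ge0_integral_density _ _ _ _ _ (X j) g P)//.
  - by apply: eq_integral => w _; rewrite (bigD1_seq j)//= mulrC EFinM.
  - exact/measurable_EFinP.
  - by move=> y; rewrite lee_fin.
rewrite ge0_integral_mscale//=; last 2 first.
- exact/measurable_EFinP.
- by move=> y _; rewrite lee_fin.
rewrite ge0_integral_distribution//; last 2 first.
- exact/measurable_EFinP.
- by move=> y; rewrite lee_fin.
by rewrite eF// muleC.
Qed.

End independence.

Lemma xsection_ler (R : realType) (y : R) :
  xsection [set z : R * R | z.1 <= z.2] y = `[y, +oo[%classic.
Proof.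
apply/seteqP; split => x; rewrite /xsection/= in_itv/= andbT.
  by move/set_mem.
by move=> yx; apply/mem_set.
Qed.

Lemma measurable_upper_tail (d : measure_display) (T : measurableType d)
    (R : realType) (P : probability T R) (X : {RV P >-> R}) :
  measurable_fun setT (fun y : R => P (X @^-1` `[y, +oo[)).
Proof.
have mD : measurable [set z : R * R | z.1 <= z.2].
  by rewrite -[X in measurable X]setTI; apply: measurable_fun_ler.
have := measurable_fun_xsection (distribution P X) mD.
apply: eq_measurable_fun => y _ /=.
by congr (P (X @^-1` _)); apply: xsection_ler.
Qed.

(** The joint law is the product of the marginals, so the event can be
  integrated along its sections. *)
Lemma probability_le_independent (d : measure_display) (T : measurableType d)
    (R : realType) (P : probability T R) (X Y : {RV P >-> R}) :
  (forall A B, measurable A -> measurable B ->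
    P (X @^-1` A `&` Y @^-1` B) = P (X @^-1` A) * P (Y @^-1` B))%E ->
  P [set w | Y w <= X w] = (\int[P]_w P (X @^-1` `[(Y w), +oo[%classic))%E.
Proof.
move=> indXY.
have mYX : measurable_fun setT (fun w => (Y w, X w)).
  exact: measurable_fun_pair.
have mD : measurable [set z : R * R | z.1 <= z.2].
  by rewrite -[X in measurable X]setTI; apply: measurable_fun_ler.
transitivity ((distribution P Y \x distribution P X)%E
    [set z : R * R | z.1 <= z.2]).
  rewrite (@product_measure_unique _ _ _ _ R (distribution P Y)
    (distribution P X) (pushforward P (fun w => (Y w, X w))))//.
  by move=> A B mA mB; rewrite muleC -indXY// setIC.
rewrite -(ge0_integral_distribution Y (measurable_upper_tail X))//.
apply: eq_integral => y _; congr (P (X @^-1` _)); exact: xsection_ler.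
Qed.

Lemma prod_fset_index_iota (R : comPzSemiRingType) n (f : nat -> R) :
  \prod_(i <- [fset i in index_iota 1 n.+1]%fset) f i =
  \prod_(1 <= i < n.+1) f i.
Proof.
apply: perm_big; apply: uniq_perm => //; first exact: iota_uniq.
by move=> i; rewrite inE.
Qed.

(** * The GEM cut-points *)

Section gem.
Context (d : measure_display) (T : measurableType d) (R : realType).
Context (P : probability T R) (theta : R) (H : nat -> {RV P >-> R}).
Context (theta0 : 0 < theta) (gemH : is_gem_sequence theta H).

Lemma gem_support :
  {ae P, forall w, forall i, (1 <= i)%N -> 0 < H i w < 1}.
Proof.
apply/ae_foralln => i; case: (posnP i) => [->|i0]; first exact/aeW.
by have := has_beta_law_support (gemH.2 _ i0); apply: filterS => w + _.
Qed.

Lemma cut_point_bounds (h : nat -> T -> R) k w :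
  (forall i, (1 <= i)%N -> 0 < h i w < 1) -> 0 <= cut_point h k w < 1.
Proof.
move=> hw; rewrite /cut_point subr_ge0 ltrBlDr ltrDl.
elim: k => [|k /andP[IH1 IH0]]; first by rewrite big_geq// lexx ltr01.
have /andP[h0 h1] := hw k.+1 isT.
rewrite big_nat_recr//= mulr_gt0 ?subr_gt0// andbT.
by rewrite mulr_ile1 ?(ltW IH0)//; lra.
Qed.

Lemma cut_point_nondecreasing (h : nat -> T -> R) w :
  (forall i, (1 <= i)%N -> 0 < h i w < 1) ->
  {homo cut_point h ^~ w : i j / (i <= j)%N >-> i <= j}.
Proof.
move=> hw; apply/nondecreasing_seqP => k.
have /andP[_ Y1] := cut_point_bounds k hw.
have /andP[h0 h1] := hw k.+1 isT.
move: Y1; rewrite /cut_point [in leRHS]big_nat_recr//=.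
by move: (\prod_(_ <= _ < _) _) => p; nra.
Qed.

Lemma measurable_cut_point k : measurable_fun setT (cut_point H k).
Proof.
apply: measurable_funB => //; apply: measurable_prod => i _.
exact: measurable_funB.
Qed.

(** 1 - Y_k is the product of the 1 - H_i; the power distributes over it where
  all factors are nonnegative, hence almost surely. *)
Lemma gem_moment k s : 0 < s ->
  (\int[P]_w ((1 - cut_point H k w) `^ s)%:E =
   ((theta / (theta + s)) ^+ k)%:E)%E.
Proof.
move=> s0.
pose S := [fset i in index_iota 1 k.+1]%fset.
transitivity (\int[P]_w (\prod_(i <- S) (1 - H i w) `^ s)%:E)%E.
  apply: ge0_ae_eq_integral => //.
  - apply/measurable_EFinP.
    apply: (measurableT_comp (measurable_powR s)); apply: measurable_funB => //.
    exact: measurable_cut_point.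
  - apply/measurable_EFinP; apply: measurable_prod => i _.
    apply: (measurableT_comp (measurable_powR s)); exact: measurable_funB.
  - by move=> w _; rewrite lee_fin powR_ge0.
  - by move=> w _; rewrite lee_fin prodr_ge0// => i _; rewrite powR_ge0.
  apply: filterS gem_support => w Hw _; congr EFin.
  rewrite prod_fset_index_iota /cut_point opprB addrC subrK.
  elim: k {S} => [|k IHk]; first by rewrite !big_geq// powR1.
  rewrite !(big_nat_recr k.+1)//= powRM ?IHk//.
    rewrite big_seq prodr_ge0// => i; rewrite mem_index_iota => /andP[/Hw].
    by move=> /andP[_ /ltW]; rewrite subr_ge0.
  by have /andP[_ /ltW] := Hw k.+1 isT; rewrite subr_ge0.
rewrite (integral_prod_independent gemH.1 (F := fun _ (x : R) => (1 - x) `^ s)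
  (e := fun=> theta / (theta + s))).
- by rewrite prod_fset_index_iota big_const_nat subn1 iter_mulr_1.
- by move=> i /=; rewrite inE mem_index_iota => /andP[].
- by move=> _; exact: measurable_onem_powR.
- by move=> i x; exact: powR_ge0.
- move=> i; rewrite inE mem_index_iota => /andP[i1 _].
  by rewrite (has_beta_law_moment (gemH.2 _ i1)).
Qed.

(** The value of E[beta_tail n b (Y_k)]: the recursion of beta_tail with the
  power (1 - y)^b replaced by its expectation. *)
Fixpoint tail_moment (n : nat) (b : R) (k : nat) : R :=
  if n is n'.+1 then tail_moment n' b k - tail_moment n' (b + 1) k
  else (theta / (theta + b)) ^+ k / b.

Lemma integral_beta_tail n b k : 0 < b ->
  P.-integrable setT (fun w => (beta_tail n b (cut_point H k w))%:E) /\
  (\int[P]_w (beta_tail n b (cut_point H k w))%:E = (tail_moment n b k)%:E)%E.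
Proof.
elim: n b => [|n IHn] b b0.
  have b0' : (0 <= b^-1%:E)%E by rewrite lee_fin invr_ge0 ltW.
  have m0 : measurable_fun setT (fun w => ((1 - cut_point H k w) `^ b)%:E).
    apply/measurable_EFinP.
    apply: (measurableT_comp (measurable_powR b)); apply: measurable_funB => //.
    exact: measurable_cut_point.
  have I0 : (\int[P]_w (beta_tail 0 b (cut_point H k w))%:E =
      (tail_moment 0 b k)%:E)%E.
    rewrite /= mulrC EFinM -(gem_moment k b0) -ge0_integralZl//; last first.
      by move=> w _; rewrite lee_fin powR_ge0.
    by apply: eq_integral => w _; rewrite mulrC EFinM.
  split=> //; apply/integrableP; split.
    under eq_fun do rewrite /= mulrC EFinM.
    exact: measurable_funeM.
  under eq_integral => w _.
    rewrite gee0_abs ?lee_fin; last first.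
      by rewrite /= mulr_ge0 ?powR_ge0// invr_ge0 ltW.
    over.
  by rewrite I0 ltry.
have [i1 I1] := IHn _ b0.
have [i2 I2] := IHn (b + 1) (addr_gt0 b0 ltr01).
split; first exact: (integrableB _ i1 i2).
transitivity (\int[P]_w ((beta_tail n b (cut_point H k w))%:E -
   (beta_tail n (b + 1) (cut_point H k w))%:E))%E; first exact: eq_integral.
by rewrite integralB// I1 I2.
Qed.

(** Y_0 = 0, so the normalizing constant of the beta law is the tail moment at
  k = 0. *)
Lemma beta_tail_moment0 n b : beta_tail n b 0 = tail_moment n b 0.
Proof.
elim: n b => [b|n IHn b] /=; first by rewrite subr0 powR1.
by rewrite !IHn.
Qed.

Lemma probability_cut_point_le n b (beta : {RV P >-> R}) k : 0 < b ->
  has_beta_law n.+1%:R b beta ->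
  independent_of_family pos_indices beta (cut_point H) ->
  P [set w | cut_point H k w <= beta w] =
  (tail_moment n b k / tail_moment n b 0)%:E.
Proof.
move=> b0 lawb indb.
pose Y : {RV P >-> R} := HB.pack (cut_point H k)
  (isMeasurableFun.Build _ _ _ _ _ (measurable_cut_point k)).
rewrite (@probability_le_independent _ _ _ _ beta Y); last first.
  move=> A B mA mB; apply: indb => //.
  (* The sigma-algebra is generated by the indices k >= 1; the cut-point of
     index 0 is the constant 0 and generates only trivial events. *)
  have [k0|k0] := posnP k.
    have -> : Y @^-1` B = if 0 \in B then setT else set0.
      apply/seteqP; split => w; rewrite /= /cut_point k0 big_geq// subrr.
        by move=> B0; rewrite mem_set.
      by case: ifPn => // /set_mem.
    rewrite /sigma_generated.
    case: ifP => _; last exact: sigma_algebra0.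
    by have := sigma_algebraCD (@sigma_algebra0 T setT _); rewrite setD0; apply.
  apply: sub_sigma_algebra; exists k => //; exists B => //.
  by rewrite setTI.
transitivity (\int[P]_w ((tail_moment n b 0)^-1%:E *
    (beta_tail n b (cut_point H k w))%:E))%E.
  apply: ae_eq_integral => //.
  - exact: (measurableT_comp (measurable_upper_tail beta)
      (measurable_cut_point k)).
  - apply: measurable_funeM; exact: measurable_int (integral_beta_tail n k b0).1.
  apply: filterS gem_support => w Hw _.
  rewrite (has_beta_law_tail lawb)//.
    by rewrite mulrC EFinM beta_tail_moment0.
  exact: cut_point_bounds.
have [i1 I1] := integral_beta_tail n k b0.
by rewrite integralZl// I1 -EFinM mulrC.
Qed.

End gem.

(** * The recursion shared by both laws *)

Section tail_moment_recursion.
Context {R : realType} (theta : R) (theta0 : 0 < theta).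
Implicit Types b : R.

(** The step subtracts the identities at b and b + 1: the constants
  b + n + 1 + theta and b + n + theta differ by 1, which is absorbed into the
  factor n + 1.  At n = 0 the factor n%:R = 0 makes the truncated index n.-1
  harmless. *)
Lemma tail_momentS n b k : 0 < b ->
  (b + n%:R + theta) * tail_moment theta n b k.+1 =
  n%:R * tail_moment theta n.-1 b k.+1 + theta * tail_moment theta n b k.
Proof.
elim: n b => [|n IHn] b b0.
  rewrite /= mul0r add0r exprS; field.
  by rewrite gt_eqF// gt_eqF// addr_gt0.
have {}IH1 := IHn b b0.
have {}IH2 := IHn (b + 1) (addr_gt0 b0 ltr01).
rewrite /= in IH1 IH2 *.
have E : n%:R * tail_moment theta n b k.+1 =
    n%:R * (tail_moment theta n.-1 b k.+1 - tail_moment theta n.-1 (b + 1) k.+1).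
  by case: n {IHn IH1 IH2} => [|n] /=; rewrite ?mul0r.
rewrite -natr1; lra.
Qed.

(** The classical relation between the normalizing constants of the beta(n+1, b)
  and beta(n+2, b) laws, by the same induction. *)
Lemma tail_moment0S n b : 0 < b ->
  (b + n.+1%:R) * tail_moment theta n.+1 b 0 = n.+1%:R * tail_moment theta n b 0.
Proof.
elim: n b => [|n IHn] b b0.
  rewrite /= !expr0; field.
  by rewrite gt_eqF// gt_eqF// addr_gt0.
have {}IH1 := IHn b b0.
have {}IH2 := IHn (b + 1) (addr_gt0 b0 ltr01).
rewrite -[in RHS]/(tail_moment theta n.+1 b 0) in IH1 IH2 *.
have E m c : tail_moment theta m.+1 c 0 =
    tail_moment theta m c 0 - tail_moment theta m (c + 1) 0 by [].
rewrite E; move: (E n b) IH1 IH2.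
move: (tail_moment theta n.+1 b 0) (tail_moment theta n.+1 (b + 1) 0)
 (tail_moment theta n b 0) (tail_moment theta n (b + 1) 0) => x y z t.
rewrite -(natr1 n.+1) => -> IH1 IH2.
lra.
Qed.

Lemma tail_moment_gt0 n b : 0 < b -> 0 < tail_moment theta n b 0.
Proof.
move=> b0; elim: n => [|n IHn]; first by rewrite /= expr0 div1r invr_gt0.
have bn0 : 0 < b + n.+1%:R by rewrite addr_gt0.
by rewrite -(pmulr_rgt0 _ bn0) tail_moment0S// mulr_gt0.
Qed.

(** The convolution of the geometric laws of parameters tau 1, ..., tau n. *)
Fixpoint geometric_sum_pmf (tau : nat -> R) (n k : nat) : R :=
  if n is n'.+1 then
    \sum_(l < k.+1) geometric_sum_pmf tau n' (k - l) * (tau n * (1 - tau n) ^+ l)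
  else (k == 0)%:R.

Lemma geometric_sum_pmfS0 tau n :
  geometric_sum_pmf tau n.+1 0 = tau n.+1 * geometric_sum_pmf tau n 0.
Proof. by rewrite /= big_ord_recl big_ord0 addr0 expr0 mulr1 subn0 mulrC. Qed.

(** Splitting off l = 0 in the convolution: a geometric variable vanishes with
  probability tau, and otherwise its predecessor is again geometric. *)
Lemma geometric_sum_pmfSS tau n k :
  geometric_sum_pmf tau n.+1 k.+1 =
  tau n.+1 * geometric_sum_pmf tau n k.+1 +
  (1 - tau n.+1) * geometric_sum_pmf tau n.+1 k.
Proof.
rewrite [LHS]/= big_ord_recl/= subn0 expr0 mulr1 mulrC; congr (_ + _).
rewrite mulr_sumr; apply: eq_bigr => l _.
by rewrite /bump/= add1n subSS exprS; ring.
Qed.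

(** Both sides satisfy the recursion of geometric_sum_pmfSS: for the right-hand
  side this is tail_momentS after normalization by tail_moment0S. *)
Lemma geometric_sum_pmf_tail n b k : 0 < b ->
  geometric_sum_pmf (geometric_parameter b theta) n.+1 k =
  (tail_moment theta n b k - tail_moment theta n b k.+1) /
  tail_moment theta n b 0.
Proof.
move=> b0.
have tauE m : geometric_parameter b theta m.+1 = (b + m%:R) / (b + m%:R + theta).
  by rewrite /geometric_parameter -natr1 addrA addrK.
have bm0 m : 0 < b + m%:R by rewrite ltr_wpDr.
have bmt0 m : 0 < b + m%:R + theta by rewrite addr_gt0.
have bmtn0 m : b + m%:R + theta != 0 by rewrite gt_eqF.
elim: n k => [|n IHn]; elim=> [|k IHk].
- rewrite geometric_sum_pmfS0 tauE /= expr0 expr1; field.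
  by rewrite !gt_eqF// ?addr_gt0//; have := bmtn0 0%N; rewrite addr0.
- rewrite geometric_sum_pmfSS IHk tauE /= !exprS; field.
  by rewrite !gt_eqF// ?addr_gt0//; have := bmtn0 0%N; rewrite addr0.
- rewrite geometric_sum_pmfS0 IHn tauE {IHn}.
  have := tail_momentS n.+1 0 b0; have := tail_moment0S n b0.
  have := tail_moment_gt0 n.+1 b0; rewrite ![n.+1.-1]/=.
  move: (tail_moment _ n.+1 b 1) (tail_moment _ n.+1 b 0) (tail_moment _ n b 1)
    (tail_moment _ n b 0) => y z' x z.
  move: (bm0 n.+1) (bmt0 n.+1) (ltr0Sn R n).
  move: n.+1%:R => N D0 T0 N0 z'0 zE yE.
  have -> : z = (b + N) * z' / N by rewrite zE; field; rewrite gt_eqF.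
  have -> : y = (N * x + theta * z') / (b + N + theta).
    by rewrite -yE; field; rewrite gt_eqF.
  by field; rewrite !gt_eqF.
rewrite geometric_sum_pmfSS IHk IHn tauE {IHk IHn}.
have := tail_momentS n.+1 k.+1 b0; have := tail_momentS n.+1 k b0.
have := tail_moment0S n b0.
have := tail_moment_gt0 n.+1 b0; rewrite ![n.+1.-1]/=.
move: (tail_moment _ n.+1 b k) (tail_moment _ n.+1 b k.+1)
  (tail_moment _ n.+1 b k.+2) (tail_moment _ n.+1 b 0) => y0 y1 y2 z'.
move: (tail_moment _ n b k.+1) (tail_moment _ n b k.+2) (tail_moment _ n b 0)
  => x1 x2 z.
move: (bm0 n.+1) (bmt0 n.+1) (ltr0Sn R n).
move: n.+1%:R => N D0 T0 N0 z'0 zE y1E y2E.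
have -> : z = (b + N) * z' / N by rewrite zE; field; rewrite gt_eqF.
have -> : y2 = (N * x2 + theta * y1) / (b + N + theta).
  by rewrite -y2E; field; rewrite gt_eqF.
have -> : x1 = ((b + N + theta) * y1 - theta * y0) / N.
  by rewrite y1E; field; rewrite gt_eqF.
by field; rewrite !gt_eqF.
Qed.

End tail_moment_recursion.

(** * Sums of independent geometric variables *)

Lemma measurable_sum_nat (d : measure_display) (T : measurableType d)
    (R : realType) (Q : probability T R) (G : nat -> {RV Q >-> nat}) m j :
  measurable [set w | (\sum_(1 <= i < m.+1) G i w)%N = j].
Proof.
elim: m j => [|m IHm] j.
  under eq_set do rewrite big_geq//.
  by have [->|/eqP j0] := eqVneq j 0%N;
    [rewrite (_ : [set _ | _] = setT)//|rewrite (_ : [set _ | _] = set0)//];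
    apply/seteqP; split => // w /= /esym.
rewrite (_ : [set _ | _] = \bigcup_(l in `I_j.+1)
    ([set w | (\sum_(1 <= i < m.+1) G i w)%N = (j - l)%N] `&`
     G m.+1 @^-1` [set l])).
  apply: bigcup_measurable => l _; apply: measurableI => //.
  exact: measurable_funPTI.
apply/seteqP; split => w /=; rewrite big_nat_recr//=.
  by move=> <-; exists (G m.+1 w) => /=; rewrite ?ltnS ?leq_addl// addnK.
by move=> [l /=]; rewrite ltnS => lj [-> ->]; rewrite subnK.
Qed.

(** The partial sums are convolved one variable at a time.  Independence of the
  partial sum from the later variables is built into the induction: the event
  on the partial sum is intersected with arbitrary events on the variables not
  yet summed. *)
Lemma probability_geometric_sum (d : measure_display) (T : measurableType d)
    (R : realType) (Q : probability T R) (tau : nat -> R) (n : nat)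
    (G : nat -> {RV Q >-> nat}) :
  mutually_independent [set i : nat | (1 <= i <= n)%N] G ->
  (forall i, (1 <= i <= n)%N -> has_geometric_law (tau i) (G i)) ->
  forall k, Q [set w | (\sum_(1 <= i < n.+1) G i w)%N = k] =
    (geometric_sum_pmf tau n k)%:E.
Proof.
move=> indG lawG.
pose E m j (A : nat -> set nat) :=
  [set w | (\sum_(1 <= i < m.+1) G i w)%N = j] `&`
  \bigcap_(i in [set i | (m < i <= n)%N]) (G i @^-1` A i).
have mE m j A : measurable (E m j A).
  apply: measurableI; first exact: measurable_sum_nat.
  by apply: bigcap_measurableType => i _; exact: measurable_funPTI.
suff QE m : (m <= n)%N -> forall j A, Q (E m j A) =
    (geometric_sum_pmf tau m j *
     \prod_(m.+1 <= i < n.+1) fine (Q (G i @^-1` A i)))%:E.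
  move=> k; have := QE n (leqnn n) k (fun=> setT).
  rewrite big_geq// mulr1 => <-; congr (Q _); apply/seteqP; split => [w ?|w []//].
  by split=> // i _.
elim: m => [_|m IHm mn] j A.
  have S0 (w : T) : (\sum_(1 <= i < 1) G i w)%N = 0%N by rewrite big_geq.
  have [->|j0] := eqVneq j 0%N; last first.
    rewrite /= (negbTE j0) mul0r (_ : E _ _ _ = set0) ?measure0//.
    apply/seteqP; split => // w [] /=.
    by rewrite S0 => /esym/eqP; rewrite (negbTE j0).
  rewrite /= mul1r.
  pose S := [fset i in index_iota 1 n.+1]%fset.
  have iS i : (i \in S) = (0 < i <= n)%N by rewrite inE mem_index_iota.
  rewrite -prod_fset_index_iota -indG//; last by move=> i /=; rewrite iS.
  congr (Q _); apply/seteqP; split => w.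
    by move=> [_ wA] i /=; rewrite iS => /wA.
  by move=> wA; split; [exact: S0|move=> i /= i1n; apply: wA => /=; rewrite iS].
(* Prescribing the value l of the next variable is an event on a variable not
   yet summed, to which the induction hypothesis applies. *)
pose A' l i := if i == m.+1 then [set l] else A i.
have -> : E m.+1 j A = \big[setU/set0]_(l < j.+1) E m (j - l)%N (A' l).
  rewrite -(bigcup_mkord j.+1 (fun l => E m (j - l)%N (A' l))).
  apply/seteqP; split => w.
    rewrite /E /= big_nat_recr//= => -[<- wA]; exists (G m.+1 w) => /=.
      by rewrite ltnS leq_addl.
    split; first by rewrite addnK.
    move=> i /= /andP[mi iN]; rewrite /A'; case: eqP => [-> //|/eqP im].
    by apply: wA; rewrite /= ltn_neqAle eq_sym im mi.
  rewrite /E => -[l /=]; rewrite ltnS => lj [/= Sw wA].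
  have Gl : G m.+1 w = l.
    by have := wA m.+1; rewrite /= /A' eqxx leqnn mn; apply.
  split; first by rewrite /= big_nat_recr//= Sw Gl subnK.
  move=> i /= /andP[mi iN]; have := wA i; rewrite /= /A' (ltnW mi) iN gtn_eqF//.
  exact.
rewrite (measure_bigsetU Q (F := fun l => E m (j - l)%N (A' l)))//; last first.
  apply/trivIsetP => l l' _ _ ll'; apply/seteqP; split=> // w [[_ wl] [_ wl']].
  have := wl' m.+1; have := wl m.+1; rewrite /= /A' eqxx leqnn mn.
  by move=> /(_ isT) -> /(_ isT) /eqP; rewrite (negbTE ll').
rewrite /= mulr_suml -sumEFin; apply: eq_bigr => l _.
rewrite IHm ?(ltnW mn)//; congr EFin; rewrite big_ltn// mulrA /A' eqxx.
rewrite -!mulrA; congr (_ * _); rewrite mulrA; congr (_ * _).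
  by rewrite -[Q _]/(distribution Q (G m.+1) [set nat_of_ord l]) lawG.
by apply: eq_big_nat => i /andP[mi _]; rewrite gtn_eqF.
Qed.

(** * Comparison of the two laws *)

Lemma eq_measure_ae (d : measure_display) (T : measurableType d) (R : realType)
    (P : probability T R) (A B : set T) : measurable A -> measurable B ->
  {ae P, forall w, A w <-> B w} -> P A = P B.
Proof.
move=> mA mB AB.
rewrite -[A]setIT -[B]setIT -!integral_indic//.
apply: ge0_ae_eq_integral => //.
- by apply/measurable_EFinP; exact: measurable_indic.
- by apply/measurable_EFinP; exact: measurable_indic.
apply: filterS AB => w ABw _; rewrite !indicE.
by congr ((nat_of_bool _)%:R%:E); apply/idP/idP => /set_mem/ABw/mem_set.
Qed.

(** The masses of the law of S sum to 1, so the events E k exhaust the space up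
  to a null set, and X takes natural values outside of it.  Events E k smaller
  than X = k are allowed, so that no description of the whole event X = k is
  needed. *)
Lemma eq_in_distribution_nat (d d' : measure_display) (T : measurableType d)
    (T' : measurableType d') (R : realType) (P : probability T R)
    (Q : probability T' R) (X : T -> \bar R) (S : T' -> nat)
    (E : nat -> set T) :
  measurable_fun setT X -> (forall k, measurable (S @^-1` [set k])) ->
  (forall k, measurable (E k)) ->
  (forall k, E k `<=` X @^-1` [set k%:R%:E]) ->
  (forall k, P (E k) = Q (S @^-1` [set k])) ->
  eq_in_distribution P Q X (fun w => (S w)%:R%:E).
Proof.
move=> mX mS mE EX PE.
have bigS : \bigcup_k S @^-1` [set k] = setT.
  by apply/seteqP; split => // w _; exists (S w).
have trS : trivIset setT (fun k => S @^-1` [set k]).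
  apply/trivIsetP => i j _ _ ij; apply/seteqP; split=> // w [/= ->] /eqP.
  by rewrite (negbTE ij).
have trE : trivIset setT E.
  apply/trivIsetP => i j _ _ ij; apply/seteqP; split=> // w [].
  by move=> /EX/= Xi /EX/=; rewrite Xi => -[] /eqP; rewrite eqr_nat (negbTE ij).
have mSA (A : set nat) : measurable (S @^-1` A).
  rewrite (_ : S @^-1` A = \bigcup_(k in A) S @^-1` [set k]).
    exact: bigcup_measurable.
  by apply/seteqP; split => w /=; [exists (S w)|move=> [k Ak /= ->]].
have mXA A : measurable A -> measurable (X @^-1` A).
  by move=> mA; rewrite -[_ @^-1` _]setTI; exact: mX.
split => //.
  by move=> _ A mA; rewrite setTI; exact: (mSA [set k | A k%:R%:E]).
move=> A mA.
have PU : P (\bigcup_k E k) = 1%E.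
  rewrite measure_bigcup// -(@probability_setT _ _ _ Q) -bigS measure_bigcup//.
  by apply: eq_eseriesr => k _; exact: PE.
have mU : measurable (\bigcup_k E k) by exact: bigcup_measurable.
have -> : P (X @^-1` A) = P (X @^-1` A `&` \bigcup_k E k).
  apply: eq_measure_ae; [exact: mXA|by apply: measurableI => //; exact: mXA|].
  have : {ae P, forall w, (\bigcup_k E k) w}.
    exists (~` \bigcup_k E k); split => //; first exact: measurableC.
    by have := probability_setC P mU; rewrite PU subee.
  by apply: filterS => w Uw; split => [|[]].
pose B := [set k : nat | A k%:R%:E].
have -> : X @^-1` A `&` \bigcup_k E k = \bigcup_(k in B) E k.
  apply/seteqP; split => w.
    move=> [Aw [k _ Ek]]; exists k => //=; rewrite /B/=.
    by have := EX _ _ Ek => /= <-.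
  by move=> [k Bk Ek]; split; [rewrite /= (EX _ _ Ek)|exists k].
have -> : (fun w => (S w)%:R%:E) @^-1` A = \bigcup_(k in B) S @^-1` [set k].
  by apply/seteqP; split => w /=; [exists (S w)|move=> [k Bk /= ->]].
rewrite !measure_bigcup//.
- by apply: eq_eseriesr => k _; exact: PE.
- exact: sub_trivIset trS.
- exact: sub_trivIset trE.
Qed.

Lemma count_cut_points_eq (T : Type) (R : realType) (Y : nat -> T -> R) u w k :
  (forall i j, (i <= j)%N -> Y i w <= Y j w) ->
  Y k w <= u < Y k.+1 w -> count_cut_points Y u w = k%:R%:E.
Proof.
move=> ndY /andP[Yk Yk1]; rewrite /count_cut_points.
rewrite (nneseries_split _ k); last by move=> i _; rewrite lee_fin.
rewrite [X in (_ + X)%E]eseries0 ?adde0; last first.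
  move=> i ki _; rewrite leNgt (lt_le_trans Yk1)//; apply: ndY.
  by rewrite -add1n.
rewrite sumEFin; congr EFin; rewrite add1n.
rewrite (eq_big_nat _ _ (F2 := fun=> 1)); last first.
  move=> i /andP[_]; rewrite ltnS => ik.
  by rewrite (le_trans _ Yk)// ndY.
by rewrite sumr_const_nat subn1.
Qed.

Theorem theorem2 (R : realType) (n : nat) (theta b : R)
    (d : measure_display) (T : measurableType d) (P : probability T R)
    (H : nat -> {RV P >-> R}) (beta : {RV P >-> R})
    (d' : measure_display) (T' : measurableType d') (Q : probability T' R)
    (G : nat -> {RV Q >-> nat}) :
  (1 <= n)%N -> 0 < theta -> 0 < b ->
  is_gem_sequence theta H ->
  has_beta_law n%:R b beta ->
  independent_of_family pos_indices beta (cut_point H) ->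
  mutually_independent [set i : nat | (1 <= i <= n)%N] G ->
  (forall i : nat, (1 <= i <= n)%N ->
     has_geometric_law (geometric_parameter b theta i) (G i)) ->
  eq_in_distribution P Q
    (fun w => count_cut_points (cut_point H) (beta w) w)
    (fun w' => ((\sum_(1 <= i < n.+1) G i w')%N%:R)%:E).
Proof.
case: n => // n _ theta0 b0 gemH lawb indb indG lawG.
(* Up to null sets, the count equals k on L k `\` L k.+1. *)
pose L k := [set w | cut_point H k w <= beta w].
have mL k : measurable (L k).
  rewrite -[L k]setTI; apply: measurable_fun_ler => //.
  exact: measurable_cut_point.
pose N w := count_cut_points (cut_point H) (beta w) w.
have mN : measurable_fun setT N.
  rewrite /N /count_cut_points.
  under eq_fun do rewrite eseries_cond.
  apply: ge0_emeasurable_sum => // k _; apply/measurable_EFinP.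
  rewrite (_ : (fun w => _) = \1_(L k)); first exact: measurable_indic.
  apply/funext => w; rewrite indicE; congr ((nat_of_bool _)%:R).
  by apply/idP/idP => [/mem_set|/set_mem].
have mNk k : measurable (N @^-1` [set k%:R%:E]).
  by rewrite -[_ @^-1` _]setTI; exact: mN.
apply: (@eq_in_distribution_nat _ _ _ _ _ _ _ _ _
  (fun k => (L k `\` L k.+1) `&` N @^-1` [set k%:R%:E])) => //.
- by move=> k; exact: measurable_sum_nat.
- by move=> k; apply: measurableI => //; exact: measurableD.
move=> k.
have Hw := gem_support gemH.
have L_sub : {ae P, forall w, forall k, L k.+1 w -> L k w}.
  apply: filterS Hw => w Hw k'; apply: le_trans.
  exact: (cut_point_nondecreasing Hw).
transitivity (P (L k `\` L k.+1)).
  apply: eq_measure_ae => //.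
  - by apply: measurableI => //; exact: measurableD.
  - exact: measurableD.
  apply: filterS Hw => w Hw; split => [[]//|Lw]; split=> //.
  apply: count_cut_points_eq; first exact: cut_point_nondecreasing.
  have [Lk /negP Lk1] := Lw; apply/andP; split => //.
  by rewrite ltNge.
have -> : P (L k `\` L k.+1) = (P (L k) - P (L k.+1))%E.
  rewrite measureD//=; last first.
    by rewrite -ge0_fin_numE// fin_num_measure.
  congr (_ - _)%E; apply: eq_measure_ae => //; first exact: measurableI.
  by apply: filterS L_sub => w Lw; split => [[]|] // Lk1; split=> //; exact: Lw.
rewrite !(probability_cut_point_le theta0 gemH _ b0 lawb indb).
rewrite (probability_geometric_sum indG lawG) geometric_sum_pmf_tail//.
by rewrite -EFinB -mulrBl.
Qed.
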